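(* Let $f:\mathbb{R}^d\to\mathbb{R}$ be differentiable with a global minimizer $w_*$, and assume that $f$ is $L$-smooth ($L>0$) and $\rho$-quasar convex ($\rho>0$) with respect to $w_*$. (i) Let $\eta_t=\frac{2}{\rho t}$, $\eta'_t=0$, $\gamma_t=\frac1L$, $\gamma'_t=\frac{\rho t}{2L}$. Then the component $w_t$ of the continuized process $(w_t,z_t)$ with these parameters satisfies, for all $t>0$, $$\mathbb{E}[f(w_t)-f(w_* )]\le \frac{2L\|z_0-w_*\|^2}{\rho^2t^2}.$$ (ii) For the discrete-time algorithm with parameters $\tau_k=1-\left(\frac{T_k}{T_{k+1}}\right)^{2/\rho}$, $\tau'_k=0$, $\tilde\gamma_k=\frac1L$, $\tilde\gamma'_k=\frac{\rho T_k}{2L}$, the iterate $\tilde w_k$ satisfies, for all $k\ge 0$, $$\mathbb{E}\left[T_k^2\left(f(\tilde w_k)-f(w_* )\right)\right]\le\frac{2L\|\tilde z_0-w_*\|^2}{\rho^2}.$$ The expectation is over the Poisson process (the random times $T_1,T_2,\dots$).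
   Context: Norms and inner products on $\mathbb{R}^d$ are Euclidean. $f$ is $L$-smooth if $f(x)\le f(y)+\langle\nabla f(y),x-y\rangle+\frac L2\|x-y\|^2$ for all $x,y\in\mathbb{R}^d$. $f$ is $\rho$-quasar convex with respect to the global minimizer $w_*$ if $f(w_* )\ge f(w)+\frac1\rho\langle\nabla f(w),w_*-w\rangle$ for all $w\in\mathbb{R}^d$. Random times: $T_0=0<T_1<T_2<\cdots$, where the increments $T_1,T_2-T_1,T_3-T_2,\dots$ are i.i.d. exponential random variables with mean $1$; $dN(t)=\sum_{k\ge1}\delta_{T_k}(dt)$ is the associated Poisson point measure. Continuized process: given parameter functions $\eta_t,\eta'_t,\gamma_t,\gamma'_t$ and deterministic initial points $w_0,z_0\in\mathbb{R}^d$, $$dw_t=\eta_t(z_t-w_t)\,dt-\gamma_t\nabla f(w_t)\,dN(t),\qquad dz_t=\eta'_t(w_t-z_t)\,dt-\gamma'_t\nabla f(w_t)\,dN(t).$$ That is, between consecutive random times $(w_t,z_t)$ solves the ODEs $\dot w_t=\eta_t(z_t-w_t)$, $\dot z_t=\eta'_t(w_t-z_t)$, and at time $T_k$ it jumps: $w_{T_k}=w_{T_k-}-\gamma_{T_k}\nabla f(w_{T_k-})$, $z_{T_k}=z_{T_k-}-\gamma'_{T_k}\nabla f(w_{T_k-})$, where $T_k-$ denotes the left limit. When $\eta_t=\frac{2}{\rho t}$ and $\eta'_t=0$, the ODE flow from time $t_0$ to $t$ is $w_t=z_{t_0}+(t_0/t)^{2/\rho}(w_{t_0}-z_{t_0})$,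 $z_t=z_{t_0}$; at the singular initial time this is used with $t_0=0$, so $w_t=z_0$ for $0<t<T_1$. Discrete-time algorithm: given (possibly random) parameters and deterministic initial points $\tilde w_0,\tilde z_0\in\mathbb{R}^d$, for $k=0,1,2,\dots$: $$\tilde v_k=\tilde w_k+\tau_k(\tilde z_k-\tilde w_k),\quad \tilde w_{k+1}=\tilde v_k-\tilde\gamma_{k+1}\nabla f(\tilde v_k),\quad \tilde z_{k+1}=\tilde z_k+\tau'_k(\tilde v_k-\tilde z_k)-\tilde\gamma'_{k+1}\nabla f(\tilde v_k).$$ *)

(* Defs.v *)
From HB Require Import structures.
From mathcomp Require Import all_boot all_order all_algebra finmap.
From mathcomp Require Import all_classical all_reals all_analysis.
Set Implicit Arguments.
Unset Strict Implicit.
Unset Printing Implicit Defensive.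
Import Order.TTheory GRing.Theory Num.Theory.
Import numFieldNormedType.Exports.
Local Open Scope classical_set_scope.
Local Open Scope ring_scope.

(* The norm `|_| that the library puts on 'rV[R]_d is the sup norm.  It is
   only used for topological notions (limits, differentiability), which do
   not depend on the norm in finite dimension; the quantitative hypotheses
   and conclusions use [dotp] and [enorm]. *)
Section Euclidean.
Context {R : realType} {d : nat}.

Definition dotp (u v : 'rV[R]_d) : R := \sum_(i < d) u 0 i * v 0 i.

Definition enorm (u : 'rV[R]_d) : R := Num.sqrt (dotp u u).

Definition grad (f : 'rV[R]_d -> R) (x : 'rV[R]_d) : 'rV[R]_d :=
  \row_(i < d) 'D_(delta_mx 0 i) f x.

Definition global_minimizer (f : 'rV[R]_d -> R) (ws : 'rV[R]_d) : Prop :=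
  forall x, f ws <= f x.

Definition smooth (L : R) (f : 'rV[R]_d -> R) : Prop :=
  forall x y,
    f x <= f y + dotp (grad f y) (x - y) + L / 2 * enorm (x - y) ^+ 2.

Definition quasar_convex (rho : R) (f : 'rV[R]_d -> R) (ws : 'rV[R]_d) : Prop :=
  forall w, f ws >= f w + rho^-1 * dotp (grad f w) (ws - w).

End Euclidean.

Section PoissonTimes.
Context {disp : measure_display} {Omega : measurableType disp} {R : realType}.
Variable P : probability Omega R.

Definition mutually_independent (X : nat -> Omega -> R) : Prop :=
  forall (J : {fset nat}) (A : nat -> set R), (forall k, measurable (A k)) ->
    P (\bigcap_(k in [set` J]) (X k @^-1` A k)) =
    (\prod_(k <- J) P (X k @^-1` A k))%E.

Definition increment (T : nat -> Omega -> R) (k : nat) : Omega -> R :=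
  T k.+1 \- T k.

(* [exponential_prob] is parametrized by the rate: mean 1 is rate 1. *)
Definition poisson_times (T : nat -> {RV P >-> R}) : Prop :=
  [/\ forall om, T 0%N om = 0,
      forall k om, T k om < T k.+1 om,
      forall k (A : set R), measurable A ->
        pushforward P (increment T k) A = exponential_prob 1 A
    & mutually_independent (increment T)].

End PoissonTimes.

Section Algorithms.
Context {R : realType} {d : nat}.
Implicit Types (T : nat -> R) (f : 'rV[R]_d -> R) (w z : R -> 'rV[R]_d).

(* One trajectory of the continuized process, for fixed jump times T.
   Nothing is said here about the right limits at T 0 = 0, so that the
   parameters may be singular at time 0: see [singular_start].  Nothing is
   said either about times beyond the supremum of the T k, which is almost
   surely infinite for Poisson times. *)
Definition continuized_path (eta eta' gamma gamma' : R -> R) f T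
    (w0 z0 : 'rV[R]_d) w z : Prop :=
  [/\ w 0 = w0 /\ z 0 = z0,
      forall k t, T k < t < T k.+1 ->
        is_derive t 1 w (eta t *: (z t - w t)) /\
        is_derive t 1 z (eta' t *: (w t - z t)),
      forall k, w @ (T k.+1)^'+ --> w (T k.+1) /\
                z @ (T k.+1)^'+ --> z (T k.+1)
    & forall k, exists wl zl : 'rV[R]_d,
        [/\ w @ (T k.+1)^'- --> wl, z @ (T k.+1)^'- --> zl,
            w (T k.+1) = wl - gamma (T k.+1) *: grad f wl
          & z (T k.+1) = zl - gamma' (T k.+1) *: grad f wl]].

(* For eta t = 2 / (rho * t) and eta' = 0, the flow started at t0 is
   w t = z0 + (t0 / t) `^ (2 / rho) *: (w0 - z0), z t = z0; this is its value
   for t0 = 0, in place of continuity at time 0. *)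
Definition singular_start T (z0 : 'rV[R]_d) w z : Prop :=
  forall t, 0 < t < T 1%N -> w t = z0 /\ z t = z0.

(* The k-th iterate, as the pair (w_k, z_k). *)
Fixpoint discrete_algorithm (tau tau' gamma gamma' : nat -> R) f
    (w0 z0 : 'rV[R]_d) (k : nat) : 'rV[R]_d * 'rV[R]_d :=
  if k is j.+1 then
    let: (w, z) := discrete_algorithm tau tau' gamma gamma' f w0 z0 j in
    let v := w + tau j *: (z - w) in
    (v - gamma j.+1 *: grad f v,
     z + tau' j *: (v - z) - gamma' j.+1 *: grad f v)
  else (w0, z0).

End Algorithms.

(* Main.v *)
Require Import Defs.
From HB Require Import structures.
From mathcomp Require Import all_boot all_order all_algebra finmap.
From mathcomp Require Import ring lra.
From mathcomp Require Import all_classical all_reals all_analysis.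
From mathcomp Require Import measurable_realfun.
Set Implicit Arguments.
Unset Strict Implicit.
Unset Printing Implicit Defensive.
Import Order.TTheory GRing.Theory Num.Theory.
Import numFieldNormedType.Exports.
Local Open Scope classical_set_scope.
Local Open Scope ring_scope.

(** The proof follows the potential
      [t ^+ 2 * (f w - f ws) + 2 * L / rho ^+ 2 * dotp (z - ws) (z - ws)]
    along the continuized process. Between jumps it varies at the rate [2 * t *
    (f w - f ws) + 2 * t / rho * dotp (grad f w) (z - w)]; a jump, which
    happens at rate one, lowers it by at least [2 * t / rho * dotp (grad f w)
    (z - ws)], since the gradient step gains enough in [f] to pay for the
    quadratic term produced by the step of [z] ([jumped_potential_le]). By
    quasar convexity the first quantity is at most the second ([drift_le]), so
    the potential is a supermartingale. It starts at [2 * L / rho ^+ 2 * dotp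
    (z0 - ws) (z0 - ws)], and both claims follow by dropping its second term.

    The supermartingale property is proved without stochastic calculus. Let a
    jump occur at time [s], and let [Phi r] be the potential at a time [r > s]
    if no jump has occurred in between. By the two inequalities above, the
    potential after a jump at time [r] is at most [Phi r - Phi' r]. Integrating
    this against the exponential law of the next jump, up to a horizon [H],
    gives [Phi s - expR (- (H - s)) * Phi H] by the fundamental theorem of
    calculus ([integral_jumped_potential_le]). The missing term is the
    contribution of the event that no jump occurs before [H], so the expected
    potential at the next jump, or at [H] if that comes first, is at most [Phi
    s] ([integral_stopped_step_le]). The next increment being independent of
    the past ([history_independent]), an induction on the number of jumps
    bounds the expectation at the time [Num.min (T k) H] by the initial value
    ([expectation_stopped_potential_le]).

    Fatou's lemma ([ge0_integral_eventually_le]) then removes one of the two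
    cut-offs. For the process at time [t], take [H = t] and let [k] grow:
    almost surely [T k > t] eventually ([poisson_times_unbounded]), and by then
    the stopped potential is the potential of the process at time [t], because
    the trajectories are determined by the jump times
    ([continuized_path_iterate]). For the discrete algorithm, which is the
    process observed at the jump times, fix [k] and let [H] grow. *)

(** * Integration *)

Section integration_tools.
Context d (T : measurableType d) (R : realType).
Local Open Scope ereal_scope.
Import HBNNSimple.

(** Only the majorant has to be measurable, because the integral of a
    nonnegative function is a supremum over the simple functions below it. This
    matters for the continuized process: its trajectories are constrained almost
    surely only, so [f (w t)] need not be measurable in the random outcome. *)
Lemma ge0_le_integral_majorant (mu : {measure set T -> \bar R}) (D : set T)
    (g h : T -> \bar R) :
  measurable D -> (forall x, D x -> 0 <= g x) -> (forall x, D x -> 0 <= h x) ->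
  measurable_fun D h -> {ae mu, forall x, D x -> g x <= h x} ->
  \int[mu]_(x in D) g x <= \int[mu]_(x in D) h x.
Proof.
move=> mD g0 h0 mh gh; rewrite integral_mkcond [leRHS]integral_mkcond.
rewrite ge0_integralTE; last exact: erestrict_ge0.
apply: ge_ereal_sup => _ [s /= sg <-].
have -> : sintegral mu s = \int[mu]_x (s x)%:E.
  by rewrite integral_nnsfun// patch_setT.
apply: ae_ge0_le_integral => //.
- by move=> x _; rewrite lee_fin.
- exact/measurable_EFinP.
- by move=> x _; exact: erestrict_ge0.
- exact/(measurable_restrictT _ _).1.
- apply: filterS gh => x ghx _; apply: le_trans (sg x) _.
  by rewrite !patchE; case: ifPn => // /set_mem; exact: ghx.
Qed.

(** The formula holds for indicators by hypothesis, hence for simple functions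
    by linearity, and passes to monotone limits. *)
Lemma ge0_integral_density (mu nu : {measure set T -> \bar R}) (p : T -> R)
    (f : T -> \bar R) :
  measurable_fun setT p -> (forall x, (0 <= p x)%R) ->
  (forall A, measurable A -> nu A = \int[mu]_(x in A) (p x)%:E) ->
  measurable_fun setT f -> (forall x, 0 <= f x) ->
  \int[nu]_x f x = \int[mu]_x (f x * (p x)%:E).
Proof.
move=> mp p0 nuE mf f0.
have mpE : measurable_fun setT (EFin \o p) by exact/measurable_EFinP.
pose h := nnsfun_approx measurableT mf.
have hf x : (EFin \o h n) x @[n --> \oo] --> f x by exact: cvg_nnsfun_approx.
transitivity (limn (fun n => \int[nu]_x (EFin \o h n) x)).
  rewrite -monotone_convergence//.
  - by apply: eq_integral => x _; apply/esym/cvg_lim => //; exact: hf.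
  - by move=> n; exact/measurable_EFinP.
  - by move=> n x _; rewrite lee_fin.
  - by move=> x _ a b ab; rewrite lee_fin; exact/lefP/nd_nnsfun_approx.
transitivity (limn (fun n =>
    \int[mu]_x ((EFin \o h n) x * (p x)%:E))); last first.
  rewrite -monotone_convergence//.
  - apply: eq_integral => x _; apply/cvg_lim => //.
    by apply: cvgeZr => //; exact: hf.
  - by move=> n; apply: emeasurable_funM => //; exact/measurable_EFinP.
  - by move=> n x _ /=; rewrite mule_ge0 ?lee_fin.
  - move=> x _ a b ab; apply: lee_wpmul2r; rewrite lee_fin//.
    exact/lefP/nd_nnsfun_approx.
congr (limn _); apply/funext => n.
transitivity (\sum_(y \in range (h n))
    \int[nu]_x (y * \1_(h n @^-1` [set y]) x)%:E).
  rewrite -ge0_integral_fsum//.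
  - by apply: eq_integral => x _; rewrite fsumEFin// -fimfunE.
  - by move=> y; exact/measurable_EFinP/measurableT_comp.
  - by move=> y x _; rewrite EFinM nnfun_muleindic_ge0.
transitivity (\sum_(y \in range (h n))
    \int[mu]_x ((y * \1_(h n @^-1` [set y]) x)%:E * (p x)%:E)); last first.
  rewrite -ge0_integral_fsum//.
  - apply: eq_integral => x _.
    rewrite -ge0_mule_fsuml; last first.
      by move=> y; rewrite EFinM nnfun_muleindic_ge0.
    by rewrite fsumEFin// -fimfunE.
  - move=> y; apply: emeasurable_funM => //.
    exact/measurable_EFinP/measurableT_comp.
  - move=> y x _; rewrite mule_ge0 ?lee_fin//.
    by rewrite -lee_fin EFinM nnfun_muleindic_ge0.
apply: eq_fsbigr => y /set_mem[x0 _ <-].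
set A := _ @^-1` _; have mA : measurable A by exact: measurable_funPTI.
under eq_integral do rewrite EFinM.
rewrite ge0_integralZl//=; last by rewrite lee_fin.
- rewrite integral_indic// setIT nuE// integral_mkcond.
  rewrite -ge0_integralZl//; last first.
  + by rewrite lee_fin.
  + by move=> x _; apply: erestrict_ge0 => ? _; rewrite lee_fin.
  + by apply/(measurable_restrictT _ _).1 => //; exact: measurable_funTS.
  apply: eq_integral => x _; rewrite EFinM -muleA; congr (_ * _).
  by rewrite patchE indicE; case: ifPn; rewrite ?mul1e ?mul0e.
- exact/measurable_EFinP.
Qed.

End integration_tools.

Section independence.
Context d d' (Om : measurableType d) (S : measurableType d') (R : realType).
Variable P : probability Om R.
Local Open Scope ereal_scope.

(** Independence says that the joint law of [H] and [X] is the product of their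
    laws; the rest is Tonelli's theorem.  Integrating [X] first plays the role
    of a conditional expectation given [H]. *)
Lemma ge0_integral_independent (H : {RV P >-> S}) (X : {RV P >-> R})
    (F : S * R -> \bar R) :
  (forall A B, measurable A -> measurable B ->
    P (H @^-1` A `&` X @^-1` B) = P (H @^-1` A) * P (X @^-1` B)) ->
  measurable_fun setT F -> (forall x, 0 <= F x) ->
  \int[P]_om F (H om, X om) =
  \int[distribution P H]_s \int[distribution P X]_u F (s, u).
Proof.
move=> indep mF F0.
have mHX : measurable_fun setT (fun om => (H om, X om)).
  exact: measurable_fun_pair.
pose HX : {mfun Om >-> (S * R)%type} :=
  HB.pack (fun om => (H om, X om)) (isMeasurableFun.Build _ _ _ _ _ mHX).
transitivity (\int[distribution P HX]_z F z).
  by rewrite ge0_integral_distribution.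
transitivity (\int[distribution P H \x distribution P X]_z F z).
  apply: eq_measure_integral => A mA _; symmetry.
  by apply: product_measure_unique => // B C mB mC; exact: indep.
exact: fubini_tonelli1.
Qed.

End independence.

Section eventual_bound.
Context d (T : measurableType d) (R : realType).
Local Open Scope ereal_scope.

(** Fatou's lemma applied to [G], together with the fact that [g] lies below the
    inferior limit. *)
Lemma ge0_integral_eventually_le (mu : {measure set T -> \bar R})
    (g : T -> \bar R) (G : nat -> T -> \bar R) (c : \bar R) :
  (forall x, 0 <= g x) -> (forall n x, 0 <= G n x) ->
  (forall n, measurable_fun setT (G n)) -> (forall n, \int[mu]_x G n x <= c) ->
  {ae mu, forall x, exists N, forall n, (N <= n)%N -> g x <= G n x} ->
  \int[mu]_x g x <= c.
Proof.
move=> g0 G0 mG Gc gG.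
have einf_ge (u : nat -> \bar R) y N : (forall n, (N <= n)%N -> y <= u n) ->
    y <= limn_einf u.
  move=> yu; rewrite limn_einf_lim; apply: lime_ge; first exact: is_cvg_einfs.
  near=> n; apply: le_ereal_inf_tmp => _ [m /= nm <-]; apply: yu.
  by rewrite (leq_trans _ nm)//; near: n; exact: nbhs_infty_ge.
apply: (@le_trans _ _ (\int[mu]_x limn_einf (G^~ x))).
  apply: ge0_le_integral_majorant => //.
  - by move=> x _; apply: (einf_ge _ _ 0%N).
  - apply: measurableT_comp => //; apply: measurable_fun_limn_esup => n.
    exact: measurableT_comp.
  - by apply: filterS gG => x [N gGN] _; exact: einf_ge gGN.
apply: (le_trans (fatou _ _ _ _)) => //.
rewrite limn_einf_lim; apply: lime_le; first exact: is_cvg_einfs.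
apply: nearW => n; apply: le_trans (Gc n).
by apply: ereal_inf_lbound; exists n => /=.
Unshelve. all: by end_near. Qed.

End eventual_bound.

(** * Independence of an increment from the past *)

Section history.
Context d (Om : measurableType d) (R : realType) (P : probability Om R).
Variable X : nat -> Om -> R.
Hypothesis mX : forall k, measurable_fun setT (X k).
Hypothesis indepX : mutually_independent P X.

Lemma probability_cylinder (A : nat -> set R) (k : nat) :
  (forall j, measurable (A j)) ->
  P (\bigcap_(j in `I_k) (X j @^-1` A j)) =
  (\prod_(j < k) P (X j @^-1` A j))%E.
Proof.
move=> mA; pose J := [fset j in iota 0 k]%fset.
have JE : [set` J] = `I_k.
  by apply/seteqP; split=> j /=; rewrite !inE/= mem_iota add0n.
rewrite -JE indepX// -(big_mkord xpredT (fun j => P (X j @^-1` A j))).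
rewrite (perm_big (iota 0 k)); last first.
  apply: uniq_perm; [exact: fset_uniq|exact: iota_uniq|].
  by move=> j; rewrite !inE.
by rewrite /index_iota subn0.
Qed.

Definition cylinder (k : nat) : set (set Om) :=
  [set C | exists2 A : nat -> set R, (forall j, measurable (A j)) &
    C = \bigcap_(j in `I_k) (X j @^-1` A j)].

(** The sigma-algebra generated by the first [k] variables, on a copy of the
    sample space: measurability of a function on [history k] means that it
    depends on these variables only. *)
Definition history (k : nat) := g_sigma_algebraType (cylinder k).

Lemma measurable_cylinder k : cylinder k `<=` measurable.
Proof.
move=> _ [A mA ->]; apply: bigcap_measurableType => j _.
by rewrite -[_ @^-1` _]setTI; exact: mX.
Qed.

Lemma measurable_history k (A : set Om) :
  measurable (A : set (history k)) -> measurable A.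
Proof.
apply: smallest_sub; first exact: sigma_algebra_measurable.
exact: measurable_cylinder.
Qed.

Lemma measurable_fun_history_id k :
  measurable_fun [set: Om] (fun om : Om => om : history k).
Proof. by move=> _ A mA; rewrite setTI; exact: measurable_history mA. Qed.

Lemma measurable_fun_history j k : (j < k)%N ->
  measurable_fun setT (X j : history k -> R).
Proof.
move=> jk _ B mB; rewrite setTI; apply: sub_gen_smallest.
exists (fun i => if i == j then B else setT) => [i|]; first by case: ifP.
apply/seteqP; split => [om Bom i _ /=|om /(_ j jk)]; last by rewrite /= eqxx.
by case: eqP => [->|].
Qed.

Lemma setI_closed_cylinder k : setI_closed (cylinder k).
Proof.
move=> _ _ [A mA ->] [B mB ->]; exists (fun j => A j `&` B j).
  by move=> j; exact: measurableI.
apply/seteqP; split=> [om [oA oB] j jk|om AB].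
  by split; [exact: oA|exact: oB].
by split=> j /AB[].
Qed.

(** The cylinder [C] together with the condition on [X k] is again a cylinder,
    over one more variable. *)
Lemma probability_cylinderI k C (B : set R) : cylinder k C -> measurable B ->
  P (C `&` X k @^-1` B) = (P C * P (X k @^-1` B))%E.
Proof.
move=> [A mA ->] mB; pose A' j := if j == k then B else A j.
have mA' j : measurable (A' j) by rewrite /A'; case: ifP.
have A'E (j : 'I_k) : A' j = A j by rewrite /A' ltn_eqF.
have := probability_cylinder k.+1 mA'.
have A'k : A' k = B by rewrite /A' eqxx.
rewrite big_ord_recr/= A'k (eq_bigr (fun j : 'I_k => P (X j @^-1` A j))).
  rewrite -probability_cylinder// => <-.
  congr (P _); apply/seteqP; split => om.
    move=> [omA omB] j/=; rewrite ltnS leq_eqVlt /A'.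
    by case: eqP => [->//|_/=]; exact: omA.
  move=> omA; split; last by have := omA k (ltnSn k); rewrite /= A'k.
  by move=> j/= jk; have := omA j (ltnW jk); rewrite /= /A' ltn_eqF.
by move=> j _; rewrite A'E.
Qed.

(** The events independent of [X k] form a Dynkin system, and it contains the
    cylinders, which are stable under intersection and generate the history. *)
Lemma history_independent k (A : set Om) (B : set R) :
  measurable (A : set (history k)) -> measurable B ->
  P (A `&` X k @^-1` B) = (P A * P (X k @^-1` B))%E.
Proof.
move=> mA mB; move: A mA.
have mXB : measurable (X k @^-1` B) by rewrite -[_ @^-1` _]setTI; exact: mX.
have fin C : measurable C -> P C \is a fin_num by exact: fin_num_measure.
have PC (C : set Om) : measurable C ->
    P (C `&` X k @^-1` B) = (P C * P (X k @^-1` B))%E ->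
    P (~` C `&` X k @^-1` B) = (P (~` C) * P (X k @^-1` B))%E.
  move=> mC PC; rewrite setIC -setDE measureD// ?ltey_eq ?fin//.
  rewrite [X in (_ - X)%E](_ : _ = P C * P (X k @^-1` B))%E; last first.
    by rewrite setIC; exact: PC.
  by rewrite probability_setC// muleBl ?fin// ?mul1e//.
have PU (F : (set Om)^nat) : (forall n, measurable (F n)) -> trivIset setT F ->
    (forall n, P (F n `&` X k @^-1` B) = (P (F n) * P (X k @^-1` B))%E) ->
    P (\bigcup_n F n `&` X k @^-1` B) =
    (P (\bigcup_n F n) * P (X k @^-1` B))%E.
  move=> mF tF PF; rewrite setI_bigcupl measure_semi_bigcup//.
  - rewrite measure_semi_bigcup//; last exact: bigcupT_measurable.
    rewrite -[X in (_ * X)%E]fineK ?fin// muleC -nneseriesZl//.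
    by apply: eq_eseriesr => n _; rewrite fineK ?fin// muleC; exact: PF.
  - by move=> n; exact: measurableI.
  - exact: trivIset_setIr.
  - by apply: bigcupT_measurable => n; exact: measurableI.
apply: (@dynkin_induction _ (history k) (cylinder k)) => //.
- exact: setI_closed_cylinder.
- by rewrite setTI probability_setT mul1e.
- by move=> C CC; exact: probability_cylinderI.
- by move=> C /measurable_history; exact: PC.
- by move=> F mF tF PF; apply: PU => // n; exact: measurable_history (mF n).
Qed.

End history.

(** * One exponential increment *)

Section lebesgue_density.
Context {R : realType}.
Local Open Scope ereal_scope.
(* The Borel sets on which Lebesgue measure is defined and those of [R] are the
   same but carry different displays; the identity mediates between them. *)
Let idR : measurableTypeR R -> R := idfun.

#[local] HB.instance Definition _ :=
  @isMeasurableFun.Build _ _ _ _ idR (@measurable_id _ _ setT).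

Lemma ge0_integral_lebesgue_density (nu : {measure set R -> \bar R})
    (p : R -> R) (f : R -> \bar R) :
  measurable_fun setT p -> (forall x, (0 <= p x)%R) ->
  (forall A, measurable A -> nu A = \int[lebesgue_measure]_(x in A) (p x)%:E) ->
  measurable_fun setT f -> (forall x, 0 <= f x) ->
  \int[nu]_x f x = \int[lebesgue_measure]_x (f x * (p x)%:E).
Proof.
move=> mp p0 nuE mf f0.
have mpE : measurable_fun setT (EFin \o p) by exact/measurable_EFinP.
rewrite (@ge0_integral_density _ _ _ (pushforward lebesgue_measure idR) _ p)//.
- rewrite ge0_integral_pushforward//.
  + exact: emeasurable_funM.
  + by move=> x _; rewrite mule_ge0// lee_fin.
- move=> A mA; rewrite ge0_integral_pushforward//; first exact: nuE.
  + exact: measurable_funTS.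
  + by move=> x _; rewrite lee_fin.
Qed.

End lebesgue_density.

Section exponential_step.
Context d (Om : measurableType d) (R : realType) (P : probability Om R).
Variable X : nat -> Om -> R.
Hypothesis mX : forall k, measurable_fun setT (X k).
Hypothesis indepX : mutually_independent P X.
Hypothesis expX : forall k (A : set R), measurable A ->
  pushforward P (X k) A = exponential_prob 1 A.
Local Open Scope ereal_scope.

(** The form in which the Markov property is used: if, for every frozen past
    [s], averaging [F] over a fresh exponential increment gives at most [G s],
    then the same inequality holds in expectation. *)
Lemma integral_history_le k (F : history X k * R -> \bar R)
    (G : history X k -> \bar R) :
  measurable_fun setT F -> (forall x, 0 <= F x) ->
  measurable_fun setT G -> (forall s, 0 <= G s) ->
  (forall s, \int[lebesgue_measure]_u (F (s, u) * (exponential_pdf 1 u)%:E)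
             <= G s) ->
  \int[P]_om F (om : history X k, X k om) <= \int[P]_om G om.
Proof.
move=> mF F0 mG G0 FG.
pose H : {RV P >-> history X k} :=
  HB.pack (fun om : Om => om : history X k)
    (isMeasurableFun.Build _ _ _ _ _ (@measurable_fun_history_id _ _ _ _ mX k)).
pose Xk : {RV P >-> R} :=
  HB.pack (X k) (isMeasurableFun.Build _ _ _ _ _ (@mX k)).
have p0 u : (0 <= exponential_pdf (1 : R) u)%R by exact: exponential_pdf_ge0.
have mp : measurable_fun setT (exponential_pdf (1 : R)).
  exact: measurable_exponential_pdf.
rewrite (@ge0_integral_independent _ _ _ _ _ _ H Xk)//; last first.
  by move=> A B mA mB; exact: history_independent.
rewrite -[leRHS](@ge0_integral_distribution _ _ _ _ _ _ H G)//.
apply: ge0_le_integral => //.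
- by move=> s _; exact: integral_ge0.
- exact: measurable_fun_fubini_tonelli_F.
- move=> s _; apply: le_trans (FG s); rewrite le_eqVlt; apply/orP; left.
  apply/eqP; apply: (@ge0_integral_lebesgue_density _ (distribution P Xk)
    (exponential_pdf 1) (fun u => F (s, u))) => //.
  + by move=> A mA; exact: expX.
  + exact: measurableT_comp.
Qed.

End exponential_step.

(** * Euclidean algebra and the gradient *)

Section euclidean.
Context {R : realType} {d : nat}.
Implicit Types (u v w x y z : 'rV[R]_d) (a : R).

Lemma dotpC u v : dotp u v = dotp v u.
Proof. by apply: eq_bigr => i _; rewrite mulrC. Qed.

Lemma dotpDl u v w : dotp (u + v) w = dotp u w + dotp v w.
Proof. by rewrite -big_split; apply: eq_bigr => i _; rewrite mxE mulrDl. Qed.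

Lemma dotpZl a u v : dotp (a *: u) v = a * dotp u v.
Proof. by rewrite mulr_sumr; apply: eq_bigr => i _; rewrite mxE mulrA. Qed.

Lemma dotpDr u v w : dotp u (v + w) = dotp u v + dotp u w.
Proof. by rewrite dotpC dotpDl dotpC (dotpC w). Qed.

Lemma dotpZr a u v : dotp u (a *: v) = a * dotp u v.
Proof. by rewrite dotpC dotpZl dotpC. Qed.

Lemma dotpNl u v : dotp (- u) v = - dotp u v.
Proof. by rewrite -scaleN1r dotpZl mulN1r. Qed.

Lemma dotpNr u v : dotp u (- v) = - dotp u v.
Proof. by rewrite dotpC dotpNl dotpC. Qed.

Definition dotpE := (dotpDl, dotpDr, dotpNl, dotpNr, dotpZl, dotpZr).

Lemma dotp_ge0 u : 0 <= dotp u u.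
Proof. by apply: sumr_ge0 => i _; rewrite -expr2 sqr_ge0. Qed.

Lemma enorm_sqr u : enorm u ^+ 2 = dotp u u.
Proof. by rewrite /enorm sqr_sqrtr// dotp_ge0. Qed.

Lemma derive_grad (f : 'rV[R]_d -> R) x v :
  differentiable f x -> 'D_v f x = dotp (grad f x) v.
Proof.
move=> dfx; rewrite deriveE// [in LHS](row_sum_delta v) linear_sum/=.
by apply: eq_bigr => i _; rewrite linearZ/= mxE deriveE// mulrC.
Qed.

Lemma cvg_dotp T (F : set_system T) (FF : Filter F) (a b : T -> 'rV[R]_d)
    (l m : 'rV[R]_d) :
  (forall i, a x 0 i @[x --> F] --> l 0 i) ->
  (forall i, b x 0 i @[x --> F] --> m 0 i) ->
  dotp (a x) (b x) @[x --> F] --> dotp l m.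
Proof.
move=> al bm; rewrite /dotp; elim: (index_enum _) => [|i r IHr].
  by under eq_fun do rewrite big_nil; rewrite big_nil; exact: cvg_cst.
under eq_fun do rewrite big_cons; rewrite big_cons.
by apply: cvgD => //; apply: cvgM.
Qed.

End euclidean.

Section semiconcave.
Context {R : realType} {V : normedModType R}.
Variables (f : V -> R) (v : V) (D : R).
Hypothesis f_diff : forall x, differentiable f x.
Hypothesis f_semiconcave : forall x t,
  f (t *: v + x) <= f x + t * 'D_v f x + D * t ^+ 2.

(** A one-sided quadratic upper bound suffices for continuity. Writing it at [y]
    for the steps [t] and [- t] squeezes the derivative at [y] between two
    difference quotients, up to [D * t]; for [t] fixed these quotients depend
    continuously on [y], and for [t] small they are close to the derivative at
    [x]. *)
Lemma semiconcave_continuous_derive : continuous ('D_v f).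
Proof.
move=> x; apply/cvgrPdist_le => /= e e0.
have e4 : 0 < e / 4 by rewrite divr_gt0.
have [D' [D0 DD']] : exists D' : R, 0 <= D' /\ D <= D'.
  by exists `|D|; rewrite normr_ge0 ler_norm.
have smooth_line y t : f (t *: v + y) <= f y + t * 'D_v f y + D' * t ^+ 2.
  by rewrite (le_trans (f_semiconcave y t))// lerD2l ler_wpM2r// sqr_ge0.
have /cvgrPdist_le/(_ _ e4) : h^-1 *: (f (h *: v + x) - f x) @[h --> 0^'] -->
    'D_v f x by exact: diff_derivable.
move=> [r /= r0 slope].
have {slope r0} [t t0 [tD slope]] : exists2 t : R, 0 < t & t * D' <= e / 4 /\
    forall s, s = t \/ s = - t ->
      `|s * 'D_v f x - (f (s *: v + x) - f x)| <= t * (e / 4).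
  (* The first argument keeps [t] and [- t] in the ball where the difference
     quotient is good, the second one makes the quadratic error small. *)
  pose t := Num.min (r / 2) (e / 4 / (D' + 1)).
  have t0 : 0 < t by rewrite lt_min !divr_gt0// ltr_wpDl.
  exists t => //; split.
    rewrite (@le_trans _ _ (e / 4 / (D' + 1) * D'))//.
      by rewrite ler_wpM2r// ge_min lexx orbT.
    by rewrite -mulrA ger_pMr// mulrC ler_pdivrMr ?ltr_wpDl// mul1r lerDl.
  move=> s sE; have nst : `|s| = t by case: sE => ->; rewrite ?normrN gtr0_norm.
  have s0 : s != 0 by rewrite -normr_gt0 nst.
  rewrite -nst -[X in _ - X](scalerKV s0) -mulrBr normrM ler_wpM2l//.
  apply: slope s0; rewrite /= sub0r normrN nst.
  by rewrite gt_min ltr_pdivrMr// ltr_pMr// ltr1n.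
have near_slope s : \forall y \near x,
    `|(f (s *: v + x) - f x) - (f (s *: v + y) - f y)| <= t * (e / 4).
  have cf y : {for y, continuous f} by exact: differentiable_continuous.
  have : f (s *: v + y) - f y @[y --> x] --> f (s *: v + x) - f x.
    apply: cvgB; last exact: cf.
    have cs : {for x, continuous (fun y => s *: v + y)}.
      by apply: cvgD; [exact: cvg_cst|exact: cvg_id].
    exact: (continuous_comp cs (cf _)).
  by move/cvgrPdist_le; apply; rewrite mulr_gt0.
near=> y.
have t_slope : `|(f (t *: v + x) - f x) - (f (t *: v + y) - f y)|
    <= t * (e / 4).
  by near: y; exact: near_slope.
have Nt_slope : `|(f (- t *: v + x) - f x) - (f (- t *: v + y) - f y)|
    <= t * (e / 4).
  by near: y; exact: near_slope.
have := slope t (or_introl erefl); have := slope (- t) (or_intror erefl).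
have := smooth_line y t; have := smooth_line y (- t).
rewrite sqrrN.
have tDt : D' * t ^+ 2 <= t * (e / 4).
  rewrite [leLHS](_ : _ = t * (t * D')); last by ring.
  exact: ler_wpM2l (ltW t0) _ _ tD.
move: t_slope Nt_slope; rewrite !ler_norml => /andP[? ?] /andP[? ?] ? ?.
move=> /andP[? ?] /andP[? ?].
rewrite -(ler_pM2l t0) -(ler_pM2l t0 _ e); apply/andP; split; lra.
Unshelve. all: by end_near. Qed.

End semiconcave.

(** * The Lyapunov function *)

Section lyapunov.
Context {R : realType} {d : nat}.
Variables (f : 'rV[R]_d -> R) (ws : 'rV[R]_d) (L rho : R).
Hypothesis f_diff : forall x, differentiable f x.
Hypothesis ws_min : global_minimizer f ws.
Hypothesis L_gt0 : 0 < L.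
Hypothesis f_smooth : smooth L f.
Hypothesis rho_gt0 : 0 < rho.
Hypothesis f_quasar : quasar_convex rho f ws.

Lemma smooth_line x v (t : R) :
  f (t *: v + x) <= f x + t * 'D_v f x + L / 2 * dotp v v * t ^+ 2.
Proof.
have := f_smooth (t *: v + x) x; rewrite addrK enorm_sqr !dotpE mulrA.
rewrite derive_grad// => /le_trans; apply; rewrite lerD2l le_eqVlt.
by apply/orP; left; apply/eqP; ring.
Qed.

Lemma continuous_grad i : continuous (fun x => grad f x 0 i).
Proof.
rewrite (_ : (fun x => _) = 'D_(delta_mx 0 i) f).
  by apply: (semiconcave_continuous_derive f_diff (smooth_line^~ _)).
by apply/funext => x; rewrite mxE.
Qed.

Definition potential (t : R) (w z : 'rV[R]_d) : R :=
  t ^+ 2 * (f w - f ws) + 2 * L / rho ^+ 2 * dotp (z - ws) (z - ws).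

(** The potential right after a jump at time [t], when [v] and [z] are the
    values right before it. *)
Definition jumped_potential (t : R) (v z : 'rV[R]_d) : R :=
  potential t (v - (1 / L) *: grad f v) (z - (rho * t / (2 * L)) *: grad f v).

Lemma potential_ge0 t w z : 0 <= potential t w z.
Proof.
rewrite addr_ge0// mulr_ge0 ?sqr_ge0 ?dotp_ge0 ?subr_ge0 ?ws_min//.
by rewrite divr_ge0 ?sqr_ge0// mulr_ge0// ltW.
Qed.

Lemma gradient_descent v :
  f (v - (1 / L) *: grad f v) <= f v - dotp (grad f v) (grad f v) / (2 * L).
Proof.
apply: le_trans (f_smooth _ v) _.
rewrite enorm_sqr (addrAC v) subrr add0r !dotpE.
rewrite le_eqVlt; apply/orP; left; apply/eqP; field; exact: lt0r_neq0.
Qed.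

(** The decrease of [f] along the gradient step cancels the quadratic term
    created by the move of [z]: this is where the step sizes [1 / L] and
    [rho * t / (2 * L)] come from. *)
Lemma jumped_potential_le t v z : 0 <= t ->
  jumped_potential t v z <=
  potential t v z - 2 * t / rho * dotp (grad f v) (z - ws).
Proof.
move=> t0; rewrite /jumped_potential /potential.
set g := grad f v.
apply: (@le_trans _ _ (t ^+ 2 * (f v - dotp g g / (2 * L) - f ws) +
    2 * L / rho ^+ 2 * dotp (z - (rho * t / (2 * L)) *: g - ws)
                            (z - (rho * t / (2 * L)) *: g - ws))).
  by rewrite lerD2r ler_wpM2l ?sqr_ge0// lerD2r gradient_descent.
rewrite (addrAC z) le_eqVlt; apply/orP; left; apply/eqP.
rewrite !(dotpDl (z - ws)) !(dotpDr _ (z - ws)).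
rewrite !(dotpNl, dotpNr, dotpZl, dotpZr).
rewrite (dotpC (z - ws) g); field.
by rewrite !lt0r_neq0.
Qed.

(** The left-hand side is the time derivative of the potential along the flow,
    the right-hand side bounds from below the decrease at a jump; quasar
    convexity is exactly the comparison of the two. *)
Lemma drift_le t v z : 0 <= t ->
  2 * t * (f v - f ws) + 2 * t / rho * dotp (grad f v) (z - v) <=
  2 * t / rho * dotp (grad f v) (z - ws).
Proof.
move=> t0; have := f_quasar v.
rewrite -(ler_pM2l rho_gt0) mulrDr mulrA mulfV ?lt0r_neq0// mul1r => quasar.
have : 0 <= 2 * t / rho by rewrite divr_ge0 ?mulr_ge0// ltW.
move=> /ler_wpM2l/(_ _ _ quasar); rewrite !dotpE.
have -> : 2 * t * (f v - f ws) = 2 * t / rho * (rho * f v - rho * f ws).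
  by field; rewrite lt0r_neq0.
move: (2 * t / rho) => c; lra.
Qed.

(** In this section [V] is a trajectory of the flow on the time interval from
    [s] to [s + h], parametrized by the time [u] elapsed since [s]. *)
Section curve.
Variables (V : R -> 'rV[R]_d) (z : 'rV[R]_d) (s h : R).
Hypotheses (s_ge0 : 0 <= s) (h_ge0 : 0 <= h).
Hypothesis V_continuous : forall u, 0 <= u <= h -> {for u, continuous V}.
Hypothesis V_derive : forall u, 0 < u < h ->
  is_derive u 1 V ((2 / (rho * (s + u))) *: (z - V u)).

Let Phi u := potential (s + u) (V u) z.
Let dPhi u := 2 * (s + u) * (f (V u) - f ws) +
  2 * (s + u) / rho * dotp (grad f (V u)) (z - V u).

Let fV_continuous u : 0 <= u <= h -> {for u, continuous (f \o V)}.
Proof.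
by move=> uh; apply: continuous_comp;
  [exact: V_continuous|exact: differentiable_continuous].
Qed.

Let Phi_continuous u : 0 <= u <= h -> {for u, continuous Phi}.
Proof.
move=> uh; apply: cvgD; last exact: cvg_cst.
apply: cvgM; last by apply: cvgB; [exact: fV_continuous|exact: cvg_cst].
have cs : {for u, continuous (+%R s)}.
  by apply: cvgD; [exact: cvg_cst|exact: cvg_id].
exact: (continuous_comp cs (@exprn_continuous _ 2 _)).
Qed.

Let dPhi_continuous u : 0 <= u <= h -> {for u, continuous dPhi}.
Proof.
move=> uh; have cs : {for u, continuous (+%R s)}.
  by apply: cvgD; [exact: cvg_cst|exact: cvg_id].
have c2s : {for u, continuous (fun u => 2 * (s + u))}.
  exact: (cvgM (cvg_cst _) cs).
have cV i : {for u, continuous (fun u => V u 0 i)}.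
  exact: (continuous_comp (V_continuous uh) (@coord_continuous _ _ _ 0 i _)).
apply: cvgD; apply: cvgM => //.
- by apply: cvgB; [exact: fV_continuous|exact: cvg_cst].
- exact: (cvgM c2s (cvg_cst _)).
- apply: cvg_dotp => i.
    exact: (continuous_comp (V_continuous uh) (@continuous_grad i _)).
  under eq_fun do rewrite !mxE; rewrite !mxE.
  by apply: cvgB; [exact: cvg_cst|exact: cV].
Qed.

Let fV_derive u : 0 < u < h -> is_derive u 1 (f \o V)
  (2 / (rho * (s + u)) * dotp (grad f (V u)) (z - V u)).
Proof.
move=> uh; have dV := V_derive uh.
have V_diff : differentiable V u by apply/derivable1_diffP; exact: ex_derive.
have fV_diff : differentiable (f \o V) u by exact: differentiable_comp.
split; first exact/derivable1_diffP.
rewrite (deriveE _ fV_diff) (diff_comp V_diff (f_diff _)).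
rewrite -[LHS]/('d f (V u) ('d V u 1)) -(deriveE _ V_diff) derive_val.
by rewrite -(deriveE _ (f_diff _)) derive_grad// dotpZr.
Qed.

Let Phi_derive u : 0 < u < h -> is_derive u 1 Phi (dPhi u).
Proof.
move=> uh; have dfV := fV_derive uh.
have su : s + u != 0 by rewrite lt0r_neq0// ltr_wpDl//; case/andP: uh.
have -> : Phi = (cst s + id) ^+ 2 * (f \o V - cst (f ws)) +
    cst (2 * L / rho ^+ 2 * dotp (z - ws) (z - ws)).
  by apply/funext => v.
apply: is_derive_eq; rewrite /dPhi !fctE /= expr1 /GRing.scale/=.
field.
by rewrite su lt0r_neq0.
Qed.

(** With [Phi] the potential along the curve, [jumped_potential_le] and
    [drift_le] bound the potential after a jump by [Phi - dPhi]; multiplied by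
    [expR (- u)] this is the derivative of [- expR (- u) * Phi u], so the bound
    integrates exactly. *)
Lemma integral_jumped_potential_le :
  (\int[lebesgue_measure]_(u in `[0%R, h])
     (expR (- u) * jumped_potential (s + u) (V u) z)%:E <=
   (potential s (V 0) z - expR (- h) * potential (s + h) (V h) z)%:E)%E.
Proof.
have [->|h0] := eqVneq h 0.
  by rewrite set_itv1 integral_set1 oppr0 expR0 mul1r addr0 subrr.
have {h0} h0 : 0 < h by rewrite lt_neqAle eq_sym h0.
pose k u := expR (- u) * (Phi u - dPhi u).
pose K u := - (expR (- u) * Phi u).
have cexp u : {for u, continuous (fun u : R => expR (- u))}.
  by apply: continuous_comp; [exact: cvgN|exact: continuous_expR].
have ck u : 0 <= u <= h -> {for u, continuous k}.
  move=> uh; apply: cvgM; first exact: cexp.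
  by apply: cvgB; [exact: Phi_continuous|exact: dPhi_continuous].
have cK u : 0 <= u <= h -> {for u, continuous K}.
  by move=> uh; apply: cvgN; apply: cvgM; [exact: cexp|exact: Phi_continuous].
have dK u : 0 < u < h -> is_derive u 1 K (k u).
  move=> uh; have dP := Phi_derive uh.
  have dexp : is_derive u 1 (fun u : R => expR (- u)) (- expR (- u)).
    rewrite -mulrN1; apply: (@is_derive1_comp _ expR -%R) => //.
  apply: is_derive_eq.
  rewrite /k /GRing.scale/=; ring.
have k_within : {within `[0, h], continuous k}.
  by apply: continuous_in_subspaceT => u; rewrite inE/= in_itv/=; exact: ck.
have jumped_le u : 0 <= u <= h ->
    expR (- u) * jumped_potential (s + u) (V u) z <= k u.
  move=> /andP[u0 _]; rewrite ler_wpM2l ?expR_ge0//.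
  have su0 : 0 <= s + u by rewrite addr_ge0.
  apply: le_trans (jumped_potential_le _ _ su0) _.
  by rewrite lerD2l lerN2 drift_le.
have jumped_ge0 u : 0 <= expR (- u) * jumped_potential (s + u) (V u) z.
  by rewrite mulr_ge0 ?expR_ge0 ?potential_ge0.
apply: (@le_trans _ _ (\int[lebesgue_measure]_(u in `[0%R, h]) (k u)%:E)%E).
  apply: ge0_le_integral_majorant => //.
  - by move=> u _; rewrite lee_fin.
  - move=> u; rewrite /= in_itv/= => uh; rewrite lee_fin.
    exact: le_trans (jumped_le _ uh).
  - apply/measurable_EFinP; exact: subspace_continuous_measurable_fun.
  - by apply: aeW => u; rewrite /= in_itv/= => uh; rewrite lee_fin jumped_le.
rewrite (@continuous_FTC2 _ _ K)//.
- by rewrite -EFinB lee_fin /K oppr0 expR0 mul1r opprK addrC /Phi addr0.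
- split.
  + by move=> u; rewrite in_itv/= => /dK duK; exact: ex_derive.
  + by apply: cvg_at_right_filter; apply: cK; rewrite lexx.
  + by apply: cvg_at_left_filter; apply: cK; rewrite lexx andbT.
- by move=> u; rewrite in_itv/= => /dK duK; rewrite derive1E derive_val.
Qed.

End curve.

End lyapunov.

(** * Measurability of vector-valued functions *)

Section measurable_vectors.
Context dS (S : measurableType dS) (R : realType) (d : nat).
Implicit Types v w : S -> 'rV[R]_d.

Definition measurable_coords v :=
  forall i, measurable_fun setT (fun s => v s 0 i).

Lemma measurable_coordsD v w : measurable_coords v -> measurable_coords w ->
  measurable_coords (fun s => v s + w s).
Proof.
by move=> mv mw i; under eq_fun do rewrite mxE; exact: measurable_funD.
Qed.

Lemma measurable_coordsZ (a : S -> R) v : measurable_fun setT a ->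
  measurable_coords v -> measurable_coords (fun s => a s *: v s).
Proof.
by move=> ma mv i; under eq_fun do rewrite mxE; exact: measurable_funM.
Qed.

Lemma measurable_coordsB v w : measurable_coords v -> measurable_coords w ->
  measurable_coords (fun s => v s - w s).
Proof.
by move=> mv mw i; under eq_fun do rewrite !mxE; exact: measurable_funB.
Qed.

Lemma measurable_coords_cst (u : 'rV[R]_d) : measurable_coords (fun=> u).
Proof. by move=> i; exact: measurable_cst. Qed.

Lemma measurable_dotp v w : measurable_coords v -> measurable_coords w ->
  measurable_fun setT (fun s => dotp (v s) (w s)).
Proof. by move=> mv mw; apply: measurable_sum => i; exact: measurable_funM. Qed.

(** Rounding the coordinates of [v] down to multiples of [1 / n.+1] gives
    functions with countably many values, for which the claim is clear; [g (v
    s)] is the limit of the values at these approximations. *)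
Lemma measurable_continuous_comp (g : 'rV[R]_d -> R) v : continuous g ->
  measurable_coords v -> measurable_fun setT (fun s => g (v s)).
Proof.
move=> cg mv.
pose k n s : 'rV[int]_d := \row_i Num.floor (n.+1%:R * v s 0 i).
pose q n (x : 'rV[int]_d) : 'rV[R]_d := \row_i ((x 0 i)%:~R / n.+1%:R).
have mk n x : measurable [set s | k n s = x].
  have -> : [set s | k n s = x] = \bigcap_(i : 'I_d)
      ((fun s => n.+1%:R * v s 0 i) @^-1` `[(x 0 i)%:~R, (x 0 i + 1)%:~R[).
    apply/seteqP; split => [s <- i _|s ks].
      by rewrite /= in_itv/= mxE floor_itv.
    apply/rowP => i; rewrite mxE; apply: floor_def.
    by have := ks i Logic.I; rewrite /= in_itv.
  apply: fin_bigcap_measurable => [|i _]; first exact: finite_finset.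
  rewrite -[X in measurable X]setTI.
  by apply: (measurable_funM (measurable_cst _) (mv i)).
apply: (@measurable_fun_cvg _ _ _ _ (fun n s => g (q n (k n s)))) => [n|s _].
  move=> _ A mA; rewrite setTI.
  rewrite (_ : _ @^-1` _ = \bigcup_(x : 'rV[int]_d)
      (if g (q n x) \in A then [set s | k n s = x] else set0)).
    apply: countable_bigcupT_measurable => [|x]; last by case: ifP.
    exact: countableP.
  apply/seteqP; split => [s As|s [x _]].
    by exists (k n s) => //; rewrite mem_set.
  by case: ifPn => // /set_mem Ax /= ->.
suff qk : q n (k n s) @[n --> \oo] --> v s by exact: (cvg_comp _ _ qk (cg _)).
apply/cvgrPdist_le => e e0; near=> n.
rewrite /Num.norm/= mx_normrE; apply: bigmax_le => [|[i j] _]; first exact: ltW.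
rewrite !mxE/= ord1.
have n0 : 0 < n.+1%:R :> R by [].
have /andP[fl ge] := floor_itv (n.+1%:R * v s 0 j).
rewrite -(ler_pM2l n0) -[X in X * `|_|]gtr0_norm// -normrM mulrBr.
rewrite mulrCA divff ?lt0r_neq0// mulr1 ger0_norm ?subr_ge0//.
apply: (@le_trans _ _ 1).
  by rewrite lerBlDl; move: ge; rewrite intrD => /ltW.
rewrite -ler_pdivrMl// mulr1 ltW//; near: n.
exact: (near_infty_natSinv_lt (PosNum e0)).
Unshelve. all: by end_near. Qed.

End measurable_vectors.

(** * The flow between jumps *)

Section scalar_derivatives.
Context {R : realType}.

Lemma is_derive_scalel (V : normedModType R) (c : R -> R) (y : V) (u dc : R) :
  is_derive u 1 c dc -> is_derive u 1 (fun r => c r *: y) (dc *: y).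
Proof.
move=> dcu; have c_diff : differentiable c u.
  by apply/derivable1_diffP; exact: ex_derive.
have [s_diff s_val] := @is_diff_scalel R V (c u) y.
have cs_diff : differentiable ( *:%R^~ y \o c) u by exact: differentiable_comp.
split; first exact/derivable1_diffP.
rewrite (_ : (fun r => _) = *:%R^~ y \o c)// deriveE// diff_comp//=.
by rewrite s_val -deriveE// derive_val.
Qed.

Lemma is_derive_ratio_powR (s u a : R) : 0 < s -> 0 < s + u ->
  is_derive u 1 (fun r => (s / (s + r)) `^ a)
    (- (a / (s + u) * (s / (s + u)) `^ a)).
Proof.
move=> s0 su0; have su : s + u != 0 by rewrite lt0r_neq0.
have dq : is_derive u 1 (fun r => s / (s + r)) (- (s / (s + u) ^+ 2)).
  have -> : (fun r => s / (s + r)) = s \*: (fun r => (s + r)^-1).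
    by apply/funext.
  have dD : is_derive u 1 (cst s + id) (1 : R).
    by apply: is_derive_eq; rewrite add0r.
  have dV := is_deriveV su dD.
  by apply: is_derive_eq; rewrite /GRing.scale/= mulr1 mulrN.
have q0 : 0 < s / (s + u) by rewrite divr_gt0.
apply: (@is_derive_eq _ _ _ _ _ _ _ _ (@is_derive1_comp _ (@powR R ^~ a)
  (fun r => s / (s + r)) u _ _ (is_derive1_powR a q0) dq)).
have -> : (s / (s + u)) `^ (a - 1) = (s / (s + u)) `^ a / (s / (s + u)).
  by rewrite powRB ?(lt0r_neq0 q0) ?implybT// powRr1// ltW.
by field; rewrite su lt0r_neq0.
Qed.

End scalar_derivatives.

(* [x^-1 = x * (x ^+ 2) `^ (- 1)], also at [x = 0] where both sides vanish. *)
Lemma measurable_inv {R : realType} : measurable_fun setT (@GRing.inv R).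
Proof.
rewrite (_ : GRing.inv = fun x : R => x * (x ^+ 2) `^ (- 1)).
  apply: measurable_funM => //.
  by apply: (@measurableT_comp _ _ _ _ _ _ (@powR R ^~ (- 1))) => //.
apply/funext => x; have [->|x0] := eqVneq x 0; first by rewrite invr0 mul0r.
by rewrite powR_inv1 ?sqr_ge0// expr2 invfM mulrA divff// mul1r.
Qed.

Section dynamics.
Context {R : realType} {d : nat}.
Variables (f : 'rV[R]_d -> R) (ws : 'rV[R]_d) (L rho : R).
Hypothesis f_diff : forall x, differentiable f x.
Hypothesis ws_min : global_minimizer f ws.
Hypothesis L_gt0 : 0 < L.
Hypothesis f_smooth : smooth L f.
Hypothesis rho_gt0 : 0 < rho.
Hypothesis f_quasar : quasar_convex rho f ws.
Implicit Types (w z : 'rV[R]_d) (s t u : R).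

Local Notation potential := (potential f ws L rho).
Local Notation jumped_potential := (jumped_potential f ws L rho).

(** The solution, at time [t], of the differential equation started at time [s]
    from [(w, z)]. For [s = 0] it is constantly [z], as the singular start
    requires. *)
Definition flow s t w z : 'rV[R]_d := z + (s / t) `^ (2 / rho) *: (w - z).

Let rate_neq0 : 2 / rho != 0.
Proof. by rewrite lt0r_neq0// divr_gt0. Qed.

Lemma flow0 t w z : flow 0 t w z = z.
Proof. by rewrite /flow mul0r powR0// scale0r addr0. Qed.

Lemma flow_id s w z : s != 0 -> flow s s w z = w.
Proof. by move=> s0; rewrite /flow divff// powR1 scale1r addrC subrK. Qed.

(** At [s = 0], where the flow forgets [w], the factor [s ^+ 2] hides it from
    the potential as well. *)
Lemma potential_flow_id s w z : potential s (flow s s w z) z = potential s w z.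
Proof.
have [->|s0] := eqVneq s 0; last by rewrite flow_id.
by rewrite /potential expr0n !mul0r.
Qed.

Lemma flow_derive s u w z : 0 <= s -> 0 < s + u ->
  is_derive u 1 (fun u => flow s (s + u) w z)
    ((2 / (rho * (s + u))) *: (z - flow s (s + u) w z)).
Proof.
rewrite le_eqVlt => /predU1P[<-|s0] su0.
  under eq_fun do rewrite flow0.
  by rewrite flow0 subrr scaler0; exact: is_derive_cst.
have := is_derive_scalel (w - z) (is_derive_ratio_powR (2 / rho) s0 su0).
move=> dc; have := is_deriveD (is_derive_cst z u 1) dc.
rewrite add0r scaleNr /flow opprD addrA subrr add0r scalerN scalerA.
rewrite (_ : 2 / (rho * (s + u)) = 2 / rho / (s + u)); first by [].
by rewrite invfM mulrA.
Qed.

Lemma flow_continuous s u w z : 0 <= s -> 0 <= u ->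
  {for u, continuous (fun u => flow s (s + u) w z)}.
Proof.
rewrite le_eqVlt => /predU1P[<-|s0] u0.
  rewrite (_ : (fun u => _) = cst z); first exact: cvg_cst.
  by apply/funext => v; exact: flow0.
have su0 : 0 < s + u by rewrite ltr_wpDr.
apply: differentiable_continuous; apply/derivable1_diffP.
by have dflow := flow_derive w z (ltW s0) su0; exact: ex_derive.
Qed.

(** The potential at the time [Num.min t H], when the previous jump was at time
    [s] with state [(w, z)] and the next one is at time [t]; if already [s] is
    beyond the horizon [H], nothing moves and the value [M] is kept. *)
Definition stopped_step (H s : R) w z (M t : R) : R :=
  if s <= H then
    if t <= H then jumped_potential t (flow s t w z) z
    else potential H (flow s H w z) z
  else M.

Lemma stopped_step_ge0 H s w z M t : 0 <= M -> 0 <= stopped_step H s w z M t.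
Proof.
move=> M0; rewrite /stopped_step.
by do 2?[case: ifP => // _]; exact: potential_ge0.
Qed.

Lemma measurable_jump dS (S : measurableType dS)
    (t : S -> R) (v z : S -> 'rV[R]_d) :
  measurable_fun setT t -> measurable_coords v -> measurable_coords z ->
  measurable_coords (fun x => v x - (1 / L) *: grad f (v x)) /\
  measurable_coords (fun x => z x - (rho * t x / (2 * L)) *: grad f (v x)).
Proof.
move=> mt mv mz; have mg : measurable_coords (fun x => grad f (v x)).
  move=> i.
  apply: (@measurable_continuous_comp _ _ _ _ (fun y => grad f y 0 i)) mv.
  exact: (continuous_grad f_diff f_smooth).
split; apply: measurable_coordsB => //; apply: measurable_coordsZ => //.
by apply: measurable_funM => //; exact: measurable_funM.
Qed.

Lemma measurable_potential dS (S : measurableType dS)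
    (t : S -> R) (w z : S -> 'rV[R]_d) :
  measurable_fun setT t -> measurable_coords w -> measurable_coords z ->
  measurable_fun setT (fun x => potential (t x) (w x) (z x)).
Proof.
move=> mt mw mz; apply: measurable_funD.
  apply: measurable_funM; first exact: measurable_funX.
  apply: measurable_funB => //; apply: measurable_continuous_comp mw => x.
  exact: differentiable_continuous.
apply: measurable_funM => //.
by apply: measurable_dotp; apply: measurable_coordsB => //;
  exact: measurable_coords_cst.
Qed.

Lemma measurable_flow dS (S : measurableType dS)
    (s t : S -> R) (w z : S -> 'rV[R]_d) :
  measurable_fun setT s -> measurable_fun setT t ->
  measurable_coords w -> measurable_coords z ->
  measurable_coords (fun x => flow (s x) (t x) (w x) (z x)).
Proof.
move=> ms mt mw mz; apply: measurable_coordsD => //; apply: measurable_coordsZ.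
  apply: (@measurableT_comp _ _ _ _ _ _ (@powR R ^~ (2 / rho))) => //.
  apply: measurable_funM => //.
  exact: (measurableT_comp measurable_inv).
exact: measurable_coordsB.
Qed.

Lemma measurable_stopped_step dS (S : measurableType dS)
    (H : R) (s t M : S -> R) (w z : S -> 'rV[R]_d) :
  measurable_fun setT s -> measurable_fun setT t -> measurable_fun setT M ->
  measurable_coords w -> measurable_coords z ->
  measurable_fun setT
    (fun x => stopped_step H (s x) (w x) (z x) (M x) (t x)).
Proof.
move=> ms mt mM mw mz; apply: measurable_fun_ifT => //.
  exact: measurable_fun_ler.
apply: measurable_fun_ifT => //; first exact: measurable_fun_ler.
- have mv := measurable_flow ms mt mw mz.
  have [mw' mz'] := measurable_jump mt mv mz.
  exact: measurable_potential.
- by apply: measurable_potential => //; exact: measurable_flow.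
Qed.

End dynamics.

(** * The supermartingale inequality *)

Section one_step.
Context {R : realType} {d : nat}.
Variables (f : 'rV[R]_d -> R) (ws : 'rV[R]_d) (L rho : R).
Hypothesis f_diff : forall x, differentiable f x.
Hypothesis ws_min : global_minimizer f ws.
Hypothesis L_gt0 : 0 < L.
Hypothesis f_smooth : smooth L f.
Hypothesis rho_gt0 : 0 < rho.
Hypothesis f_quasar : quasar_convex rho f ws.
Implicit Types (w z : 'rV[R]_d) (s t u : R).
Local Notation potential := (potential f ws L rho).
Local Notation stopped_step := (stopped_step f ws L rho).

Let exponential_survival (h : R) : 0 <= h ->
  (\int[lebesgue_measure]_(u in (~` `[0%R, h])%classic)
     (exponential_pdf 1 u)%:E = (expR (- h))%:E)%E.
Proof.
move=> h0; have p0 u : 0 <= exponential_pdf (1 : R) u.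
  exact: exponential_pdf_ge0.
have mp : measurable_fun setT (EFin \o exponential_pdf (1 : R)).
  by apply/measurable_EFinP; exact: measurable_exponential_pdf.
have : (\int[lebesgue_measure]_u (exponential_pdf (1 : R) u)%:E = 1)%E.
  exact: integral_exponential_pdf.
rewrite -(setUv `[0, h]%classic) ge0_integral_setU//=; last 4 first.
- exact: measurableC.
- by rewrite setUv.
- by move=> u _; rewrite lee_fin.
- exact/disj_setPCl.
have -> : (\int[lebesgue_measure]_(u in `[0%R, h]) (exponential_pdf 1 u)%:E =
    1 - (expR (- h))%:E)%E.
  have [->|h_neq0] := eqVneq h 0.
    by rewrite set_itv1 integral_set1 oppr0 expR0 subee.
  have := @exponential_prob_itv0c R 1 h; rewrite mulN1r; apply.
  by rewrite lt_neqAle eq_sym h_neq0.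
by case: (\int[_]_(_ in ~` _) _)%E => [r|//|//] [re]; congr EFin; lra.
Qed.

(** If the next jump comes before the horizon, its contribution is the integral
    bounded by [integral_jumped_potential_le]; otherwise, with probability
    [expR (- (H - s))], the potential is read off at [H], and this is precisely
    the term subtracted in that bound. *)
Lemma integral_stopped_step_le (H s : R) w z (M : R) : 0 <= s -> 0 <= M ->
  (\int[lebesgue_measure]_u
     ((stopped_step H s w z M (s + u))%:E * (exponential_pdf 1 u)%:E) <=
   (if s <= H then potential s w z else M)%:E)%E.
Proof.
move=> s0 M0; have p0 u : 0 <= exponential_pdf (1 : R) u.
  exact: exponential_pdf_ge0.
have mp : measurable_fun setT (EFin \o exponential_pdf (1 : R)).
  by apply/measurable_EFinP; exact: measurable_exponential_pdf.
have step0 t : 0 <= stopped_step H s w z M t.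
  exact: stopped_step_ge0.
case: (leP s H) => sH; last first.
  have stepE t : stopped_step H s w z M t = M by rewrite /stopped_step leNgt sH.
  under eq_integral do rewrite stepE.
  rewrite ge0_integralZl//; last by move=> u _; rewrite lee_fin.
  by rewrite integral_exponential_pdf// mule1.
pose h := H - s; have h0 : 0 <= h by rewrite subr_ge0.
have mstep : measurable_fun setT (fun u => stopped_step H s w z M (s + u)).
  apply: measurable_stopped_step => //; try exact: measurable_coords_cst.
  exact: measurable_funD.
rewrite -(setUv `[0, h]%classic) ge0_integral_setU//=; last 4 first.
- exact: measurableC.
- rewrite setUv; apply: emeasurable_funM => //; exact/measurable_EFinP.
- by move=> u _; rewrite mule_ge0// lee_fin.
- exact/disj_setPCl.
set c := potential H (flow rho s H w z) z.
have c0 : 0 <= c by exact: potential_ge0.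
rewrite [X in (_ + X)%E](_ : _ = (expR (- h) * c)%:E); last first.
  rewrite EFinM muleC -exponential_survival// -ge0_integralZl//; last 3 first.
  - exact: measurableC.
  - exact: measurable_funTS.
  - by move=> u _; rewrite lee_fin.
  apply: eq_integral => u; rewrite inE/= in_itv/= => /negP.
  rewrite negb_and -!ltNge => /orP[u0|hu].
    by rewrite lt0_exponential_pdf// !mule0.
  by rewrite /stopped_step sH leNgt -ltrBlDl hu.
have curve := @integral_jumped_potential_le R d f ws L rho f_diff ws_min L_gt0
  f_smooth rho_gt0 f_quasar (fun u => flow rho s (s + u) w z) z s h s0.
rewrite [X in (X + _)%E](_ : _ = \int[lebesgue_measure]_(u in `[0%R, h])
  (expR (- u) * jumped_potential f ws L rho (s + u)
    (flow rho s (s + u) w z) z)%:E)%E.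
  have Hsh : H = s + h by rewrite addrC subrK.
  apply: (@le_trans _ _ ((potential s (flow rho s (s + 0) w z) z -
    expR (- h) * potential (s + h) (flow rho s (s + h) w z) z)%:E +
    (expR (- h) * c)%:E)%E); last first.
    by rewrite -EFinD lee_fin addr0 potential_flow_id -Hsh subrK.
  rewrite leeD2r//; apply: curve => // u /andP[u0 uh].
    exact: flow_continuous.
  by apply: flow_derive => //; rewrite ltr_wpDl.
apply: eq_integral => u; rewrite inE/= in_itv/= => /andP[u0 uh].
rewrite -EFinM exponential_pdfE// mul1r mulN1r mulrC /stopped_step sH.
by rewrite -lerBrDl uh.
Qed.

End one_step.

(** * The process stopped at a horizon *)

Section stopped_process.
Context {R : realType} {d : nat}.
Variables (f : 'rV[R]_d -> R) (ws : 'rV[R]_d) (L rho : R) (w0 z0 : 'rV[R]_d).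
Hypothesis f_diff : forall x, differentiable f x.
Hypothesis ws_min : global_minimizer f ws.
Hypothesis L_gt0 : 0 < L.
Hypothesis f_smooth : smooth L f.
Hypothesis rho_gt0 : 0 < rho.
Hypothesis f_quasar : quasar_convex rho f ws.
Implicit Types (t : nat -> R) (H : R).
Local Notation potential := (potential f ws L rho).

Definition iterate t (k : nat) : 'rV[R]_d * 'rV[R]_d :=
  discrete_algorithm (fun j => 1 - (t j / t j.+1) `^ (2 / rho)) (fun=> 0)
    (fun=> 1 / L) (fun j => rho * t j / (2 * L)) f w0 z0 k.

(** The choice of [tau] makes the intermediate point of the algorithm the value
    of the flow just before the jump. *)
Lemma iterateS t k :
  let v := flow rho (t k) (t k.+1) (iterate t k).1 (iterate t k).2 in
  iterate t k.+1 = (v - (1 / L) *: grad f v,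
    (iterate t k).2 - (rho * t k.+1 / (2 * L)) *: grad f v).
Proof.
rewrite /iterate /=; case: (discrete_algorithm _ _ _ _ _ _ _ _) => w z /=.
have -> : w + (1 - (t k / t k.+1) `^ (2 / rho)) *: (z - w) =
  flow rho (t k) (t k.+1) w z by apply/rowP => i; rewrite !mxE; ring.
by rewrite scale0r addr0.
Qed.

(** The potential of the continuized process at time [Num.min (t k) H].  It is a
    function of the jump times alone, so that it can be integrated whatever the
    process is on the exceptional null set. *)
Fixpoint stopped_potential H t (k : nat) : R :=
  if k is j.+1 then
    stopped_step f ws L rho H (t j) (iterate t j).1 (iterate t j).2
      (stopped_potential H t j) (t j.+1)
  else potential 0 w0 z0.

Lemma stopped_potential_ge0 H t k : 0 <= stopped_potential H t k.
Proof.
by elim: k => [|k IHk] /=; [exact: potential_ge0|exact: stopped_step_ge0].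
Qed.

Lemma stopped_potential_before H t k : t 0%N = 0 ->
  (forall j, t j < t j.+1) -> t k <= H ->
  stopped_potential H t k = potential (t k) (iterate t k).1 (iterate t k).2.
Proof.
move=> t0 tlt; case: k => [|k] tH /=; first by rewrite t0.
rewrite /stopped_step (le_trans (ltW (tlt k)) tH) tH /jumped_potential.
by have /= := iterateS t k; rewrite /iterate /= => ->.
Qed.

Lemma stopped_potential_after H t k n : (forall j, t j < t j.+1) ->
  t k <= H < t k.+1 -> (k < n)%N ->
  stopped_potential H t n =
  potential H (flow rho (t k) H (iterate t k).1 (iterate t k).2)
    (iterate t k).2.
Proof.
move=> tlt /andP[tkH Htk]; elim: n => // n IHn; rewrite ltnS leq_eqVlt.
case/predU1P => [<-|kn] /=; first by rewrite /stopped_step tkH leNgt Htk.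
rewrite /stopped_step leNgt (lt_le_trans Htk) ?IHn//.
exact: (homo_leq (@lexx _ _) (@le_trans _ _) (fun j => ltW (tlt j))).
Qed.

Lemma measurable_iterate dS (S : measurableType dS) (t : nat -> S -> R) k :
  (forall j, (j <= k)%N -> measurable_fun setT (t j)) ->
  measurable_coords (fun s => (iterate (t^~ s) k).1) /\
  measurable_coords (fun s => (iterate (t^~ s) k).2).
Proof.
elim: k => [|k IHk] mt; first by split; exact: measurable_coords_cst.
have [|mw mz] := IHk; first by move=> j jk; apply: mt; exact: leqW.
have mv := measurable_flow rho (mt k (leqnSn k)) (mt k.+1 (leqnn _)) mw mz.
have [mw' mz'] :=
  measurable_jump rho f_diff f_smooth (mt k.+1 (leqnn _)) mv mz.
have iterE s := iterateS (t^~ s) k.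
by split=> i;
  [apply: eq_measurable_fun (mw' i)|apply: eq_measurable_fun (mz' i)] => s _;
  rewrite iterE.
Qed.

Lemma measurable_stopped_potential dS (S : measurableType dS) H
    (t : nat -> S -> R) k :
  (forall j, (j <= k)%N -> measurable_fun setT (t j)) ->
  measurable_fun setT (fun s => stopped_potential H (t^~ s) k).
Proof.
elim: k => [|k IHk] mt; first exact: measurable_cst.
have mt' j : (j <= k)%N -> measurable_fun setT (t j).
  by move=> jk; apply: mt; exact: leqW.
have [mw mz] := measurable_iterate mt'.
by apply: (measurable_stopped_step ws rho f_diff f_smooth) => //;
  [exact: mt'|exact: mt|exact: IHk].
Qed.

Section expectation.
Context disp (Om : measurableType disp) (P : probability Om R).
Variable T : nat -> {RV P >-> R}.
Hypothesis T_poisson : poisson_times T.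

Lemma poisson_time_measurable_history j k : (j <= k)%N ->
  measurable_fun setT (T j : history (increment T) k -> R).
Proof.
have [T0 _ _ _] := T_poisson.
have mI i : measurable_fun setT (increment T i) by exact: measurable_funB.
elim: j => [|j IHj] jk.
  by rewrite (_ : (T 0%N : _ -> _) = cst 0) //; apply/funext => om; rewrite T0.
have -> : (T j.+1 : Om -> R) = (T j \+ increment T j).
  by apply/funext => om; rewrite /increment/= addrC subrK.
apply: measurable_funD; first by apply: IHj; exact: ltnW.
exact: measurable_fun_history.
Qed.

(** Given the first [k] increments, [stopped_potential H T k.+1] depends on the
    next increment only, and its average over it is at most
    [stopped_potential H T k]. *)
Lemma expectation_stopped_potential_le H k :
  (\int[P]_om (stopped_potential H (fun j => T j om) k)%:E <=
   (potential 0 w0 z0)%:E)%E.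
Proof.
have [T0 Tlt expT indepT] := T_poisson.
have mI i : measurable_fun setT (increment T i) by exact: measurable_funB.
have T_ge0 j om : 0 <= T j om.
  by elim: j => [|j IHj]; [rewrite T0|exact: le_trans IHj (ltW (Tlt j om))].
elim: k => [|k IHk].
  rewrite [leRHS](_ : _ = (potential 0 w0 z0)%:E * P setT)%E.
    by rewrite -(integral_cst P measurableT); exact: lexx.
  by have -> : P setT = 1%E; [exact: probability_setT|rewrite mule1].
apply: le_trans IHk.
pose M (s : history (increment T) k) := stopped_potential H (fun j => T j s) k.
pose it (s : history (increment T) k) := iterate (fun j => T j s) k.
have mT j : (j <= k)%N ->
    measurable_fun setT (T j : history (increment T) k -> R).
  exact: poisson_time_measurable_history.
have mM : measurable_fun setT M by exact: measurable_stopped_potential.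
have [mw mz] := measurable_iterate mT.
pose F (x : history (increment T) k * R) : \bar R :=
  (stopped_step f ws L rho H (T k x.1) (it x.1).1 (it x.1).2 (M x.1)
     (T k x.1 + x.2))%:E.
have FE om : F (om, increment T k om) =
    (stopped_potential H (fun j => T j om) k.+1)%:E.
  by rewrite /F /= /increment /= [_ + (_ - _)]addrC subrK.
under eq_integral do rewrite -FE.
have FM s : (\int[lebesgue_measure]_u (F (s, u) * (exponential_pdf 1 u)%:E) <=
    (M s)%:E)%E.
  have M0 : 0 <= M s by exact: stopped_potential_ge0.
  apply: (le_trans (integral_stopped_step_le f_diff ws_min L_gt0 f_smooth
    rho_gt0 f_quasar H (it s).1 (it s).2 (T_ge0 k s) M0)).
  by case: ifP => // TH; rewrite lee_fin /M stopped_potential_before.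
apply: (integral_history_le mI indepT expT _ _ _ _ FM).
- apply/measurable_EFinP.
  apply: (measurable_stopped_step ws rho f_diff f_smooth).
  + exact: (measurableT_comp (mT k (leqnn k)) measurable_fst).
  + apply: measurable_funD => //.
    exact: (measurableT_comp (mT k (leqnn k)) measurable_fst).
  + exact: (measurableT_comp mM measurable_fst).
  + by move=> i; exact: (measurableT_comp (mw i) measurable_fst).
  + by move=> i; exact: (measurableT_comp (mz i) measurable_fst).
- by move=> x; rewrite lee_fin stopped_step_ge0 // stopped_potential_ge0.
- exact/measurable_EFinP.
- by move=> s; rewrite lee_fin stopped_potential_ge0.
Qed.

End expectation.

End stopped_process.

(** * The jump times are unbounded *)

Section non_explosion.
Context disp (Om : measurableType disp) (R : realType) (P : probability Om R).
Variable T : nat -> {RV P >-> R}.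
Hypothesis T_poisson : poisson_times T.

(** If all the [T k] are at most [H], then so are all the increments; for the
    first [n] of them this has probability at most [q ^+ n], with [q < 1]. *)
Lemma poisson_times_unbounded (H : R) : {ae P, forall om, exists k, H < T k om}.
Proof.
have [T0 Tlt expT indepT] := T_poisson.
have mI i : measurable_fun setT (increment T i) by exact: measurable_funB.
have T_ge0 j om : 0 <= T j om.
  by elim: j => [|j IHj]; [rewrite T0|exact: le_trans IHj (ltW (Tlt j om))].
pose h := Num.max H 1; have h0 : 0 < h by rewrite lt_max ltr01 orbT.
pose q := 1 - expR (- h).
have q0 : 0 <= q by rewrite subr_ge0 -[leRHS]expR0 ler_expR lerNl oppr0 ltW.
have q1 : `|q| < 1 by rewrite ger0_norm// ltrBlDr ltrDl expR_gt0.
have PX j : P (increment T j @^-1` `[0, h]) = q%:E.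
  rewrite -[LHS]/(pushforward P (increment T j) `[0, h]) expT//.
  by rewrite exponential_prob_itv0c// mulN1r -EFinB.
pose A := \bigcap_k [set om | T k om <= H].
have mA : measurable A.
  apply: bigcapT_measurable => k.
  rewrite (_ : [set om | _] = T k @^-1` `]-oo, H]).
    exact: measurable_funPTI.
  by apply/seteqP; split => om /=; rewrite in_itv.
have PA n : (P A <= (q ^+ n)%:E)%E.
  rewrite (_ : (q ^+ n)%:E = P (\bigcap_(j in `I_n)
      (increment T j @^-1` `[0, h]))); last first.
    rewrite (@probability_cylinder _ _ _ _ _ indepT
      (fun=> `[0, h]%classic) n)//.
    by rewrite (eq_bigr (fun=> q%:E)) // prodEFin prodr_const card_ord.
  apply: le_measure; rewrite ?inE//.
    apply: bigcap_measurableType => j _; rewrite -[X in measurable X]setTI.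
    exact: mI.
  move=> om AT j _ /=; rewrite in_itv/= /increment subr_ge0 ltW//=.
  by rewrite lerBlDr (le_trans (AT j.+1 Logic.I))// ler_wpDr// le_max lexx.
have PA0 : P A = 0%E.
  apply/eqP; rewrite eq_le measure_ge0 andbT.
  have PAfin : P A \is a fin_num by exact: fin_num_measure.
  rewrite -(fineK PAfin) lee_fin.
  have q_lim : q ^+ n @[n --> \oo] --> 0 by exact: cvg_expr.
  rewrite -(cvg_lim (@Rhausdorff R) q_lim); apply: limr_ge.
    by apply/cvg_ex; exists 0.
  by apply: nearW => n; rewrite -lee_fin (fineK PAfin).
exists A; split => // om /= noT k _ /=; rewrite leNgt; apply/negP => HT.
by apply: noT; exists k.
Qed.

End non_explosion.

(** * Trajectories of the continuized process *)

Section trajectories.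
Context {R : realType}.

Lemma derive0_right_limit (g : R -> R) (s e l : R) :
  (forall r, s < r < e -> is_derive r 1 g 0) -> g @ s^'+ --> l ->
  forall r, s < r < e -> g r = l.
Proof.
move=> dg gl r sre.
have g_cst x y : s < x -> x <= y -> y < e -> g x = g y.
  move=> sx xy ye.
  have xy_in v : x <= v <= y -> s < v < e.
    by move=> /andP[xv vy]; rewrite (lt_le_trans sx xv) (le_lt_trans vy ye).
  have [||c _] := @MVT_segment _ g (cst 0) x y xy.
  - move=> v; rewrite in_itv/= => /andP[xv vy].
    by apply: dg; apply: xy_in; rewrite !ltW.
  - apply: continuous_in_subspaceT => v.
    rewrite inE/= in_itv/= => /xy_in/dg dgv.
    apply: differentiable_continuous; apply/derivable1_diffP.
    exact: ex_derive.
  - by rewrite mul0r => /eqP; rewrite subr_eq0 => /eqP.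
apply: (@cvg_unique _ _ (g @ s^'+)) => //.
have /andP[sr re] := sre.
apply: (cvg_trans _ (@cvg_cst _ (g r) _ (s^'+) _)).
apply: near_eq_cvg; near=> x.
have sx : s < x by near: x; exact: nbhs_right_gt.
have xr : x <= r by near: x; exact: nbhs_right_ltW.
exact/esym/g_cst.
Unshelve. all: by end_near. Qed.

End trajectories.

Section path_identification.
Context {R : realType} {d : nat}.
Variables (f : 'rV[R]_d -> R) (L rho : R) (w0 z0 : 'rV[R]_d).
Hypothesis rho_gt0 : 0 < rho.
Implicit Types (w z : R -> 'rV[R]_d).

Let is_derive_coord (v : R -> 'rV[R]_d) (r : R) (dv : 'rV[R]_d) (i : 'I_d) :
  is_derive r 1 v dv -> is_derive r 1 (fun x => v x 0 i) (dv 0 i).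
Proof.
move=> vr; have v_ex : derivable v r 1 by exact: ex_derive.
split; first exact: (derivable_mxP v r 1).1.
by have := derive_mx v_ex; rewrite derive_val => ->; rewrite mxE.
Qed.

Let cvg_coord (F : set_system R) (FF : Filter F) (v : R -> 'rV[R]_d)
    (l : 'rV[R]_d) (i : 'I_d) :
  v @ F --> l -> (fun x => v x 0 i) @ F --> l 0 i.
Proof.
by move=> vl; exact: (cvg_comp _ _ vl (@coord_continuous _ _ _ 0 i l)).
Qed.

(** The second component is constant, and then [r `^ (2 / rho) * (w r - zs)] is
    a first integral of the equation for the first one. *)
Lemma ode_flow w z (s e : R) (ws zs : 'rV[R]_d) : 0 < s ->
  (forall r, s < r < e ->
    is_derive r 1 w ((2 / (rho * r)) *: (z r - w r)) /\
    is_derive r 1 z (0 *: (w r - z r))) ->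
  w @ s^'+ --> ws -> z @ s^'+ --> zs ->
  forall r, s < r < e -> w r = flow rho s r ws zs /\ z r = zs.
Proof.
move=> s0 ode wws zzs.
have zE r : s < r < e -> z r = zs.
  move=> sre; apply/rowP => i.
  apply: (@derive0_right_limit _ (fun x => z x 0 i) s e) => //.
    move=> x sxe; have [_ dz] := ode x sxe.
    by have := is_derive_coord i dz; rewrite scale0r mxE.
  exact: cvg_coord.
move=> r sre; split; last exact: zE.
have r0 : 0 < r by case/andP: sre => sr _; exact: lt_trans sr.
apply/rowP => i.
pose a := 2 / rho.
have : r `^ a * (w r 0 i - zs 0 i) = s `^ a * (ws 0 i - zs 0 i).
  apply: (@derive0_right_limit _
    (fun x => x `^ a * (w x 0 i - zs 0 i)) s e) => //.
    move=> x sxe; have x0 : 0 < x by case/andP: sxe => sx _; exact: lt_trans sx.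
    have [dw _] := ode x sxe.
    have dwi := is_derive_coord i dw.
    have dp := is_derive1_powR a x0.
    have := is_deriveM dp (is_deriveB dwi (is_derive_cst (zs 0 i) x 1)).
    move=> H; apply: (is_derive_eq H).
    rewrite /GRing.scale/= !mxE subr0 (zE x sxe).
    rewrite powRB ?(lt0r_neq0 x0) ?implybT// powRr1 ?(ltW x0)// /a !fctE; field.
    by rewrite !lt0r_neq0.
  apply: cvgM.
    have cpow : {for s, continuous (@powR R ^~ a)}.
      apply: differentiable_continuous; apply/derivable1_diffP.
      by have dp := is_derive1_powR a s0; exact: ex_derive.
    exact: (cvg_at_right_filter cpow).
  by apply: cvgB; [exact: cvg_coord|exact: cvg_cst].
have -> : s `^ a = r `^ a * (s / r) `^ a.
  rewrite -powRM ?divr_ge0 ?ltW//; congr (_ `^ _).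
  by rewrite mulrC divfK ?lt0r_neq0.
have ra : r `^ a != 0 by rewrite powR_eq0 negb_and (lt0r_neq0 r0).
by rewrite -mulrA => /(mulfI ra) wE; rewrite !mxE -/a -wE addrC subrK.
Qed.

Lemma flow_continuous_at (s t : R) (w1 z1 : 'rV[R]_d) :
  0 <= s -> 0 < t -> s <= t ->
  {for t, continuous (fun r => flow rho s r w1 z1)}.
Proof.
move=> s0 t0 st.
rewrite (_ : (fun r => _) =
  (fun u => flow rho s (s + u) w1 z1) \o (fun r => r - s)).
  apply: continuous_comp.
    by apply: cvgB; [exact: cvg_id|exact: cvg_cst].
  by apply: flow_continuous => //; rewrite subr_ge0.
by apply/funext => r /=; rewrite addrC subrK.
Qed.

(** The discrete algorithm is the continuized process observed at its jump
    times, and between two jumps the process follows the flow. *)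
Lemma continuized_path_iterate (t : nat -> R) w z :
  t 0%N = 0 -> (forall k, t k < t k.+1) ->
  continuized_path (fun r => 2 / (rho * r)) (fun=> 0) (fun=> 1 / L)
    (fun r => rho * r / (2 * L)) f t w0 z0 w z ->
  singular_start t z0 w z ->
  forall k, (w (t k), z (t k)) = iterate f L rho w0 z0 t k /\
    forall r, t k < r < t k.+1 ->
      w r = flow rho (t k) r (iterate f L rho w0 z0 t k).1
                             (iterate f L rho w0 z0 t k).2 /\
      z r = (iterate f L rho w0 z0 t k).2.
Proof.
move=> t0 tlt [[w_0 z_0] ode rc jump] start.
have t_ge0 k : 0 <= t k.
  by elim: k => [|k IHk]; [rewrite t0|exact: le_trans IHk (ltW (tlt k))].
have t_gt0 k : 0 < t k.+1 by exact: le_lt_trans (t_ge0 k) (tlt k).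
elim=> [|k [wzk between]].
  split; first by rewrite t0 w_0 z_0.
  by rewrite t0 => r /start[-> ->]; rewrite flow0.
have wzk1 : (w (t k.+1), z (t k.+1)) = iterate f L rho w0 z0 t k.+1.
  have [wl [zl [wwl zzl -> ->]]] := jump k.
  have near_between : \forall r \near (t k.+1)^'-, t k < r < t k.+1.
    near=> r; apply/andP; split; near: r.
      exact: nbhs_left_gt.
    exact: nbhs_left_lt.
  have -> : zl = (iterate f L rho w0 z0 t k).2.
    apply: (@cvg_unique _ (@norm_hausdorff _ _) (z @ (t k.+1)^'-)) => //.
    by apply: cvg_near_cst; apply: filterS near_between => r /between[_ ->].
  have -> : wl = flow rho (t k) (t k.+1) (iterate f L rho w0 z0 t k).1
      (iterate f L rho w0 z0 t k).2.
    apply: (@cvg_unique _ (@norm_hausdorff _ _) (w @ (t k.+1)^'-)) => //.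
    have := @flow_continuous_at (t k) (t k.+1) (iterate f L rho w0 z0 t k).1
      (iterate f L rho w0 z0 t k).2 (t_ge0 k) (t_gt0 k) (ltW (tlt k)).
    move=> /cvg_at_left_filter; apply: cvg_trans.
    apply: near_eq_cvg; apply: filterS near_between => r /between[-> _] //.
  by rewrite iterateS.
split=> // r tr; have [wr zr] := rc k.
have := ode_flow (t_gt0 k) (ode k.+1) wr zr tr.
by rewrite -wzk1.
Unshelve. all: by end_near. Qed.

End path_identification.

(** * The convergence rates *)

Section jump_index.
Context {R : realType}.

Lemma jump_index (t : nat -> R) (H : R) k : t 0%N <= H -> H < t k ->
  exists j, t j <= H < t j.+1.
Proof.
move=> t0 Ht; have ex : exists n, H < t n by exists k.
case: (ex_minnP ex) => -[|j] Hj minj; first by move: Hj; rewrite ltNge t0.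
exists j; rewrite Hj andbT leNgt; apply/negP => /minj.
by rewrite ltnn.
Qed.

End jump_index.

Theorem theorem1 (R : realType) (d : nat) (f : 'rV[R]_d -> R) (ws : 'rV[R]_d)
    (L rho : R)
    (disp : measure_display) (Omega : measurableType disp)
    (P : probability Omega R) (T : nat -> {RV P >-> R})
    (f_diff : forall x : 'rV[R]_d, differentiable f x)
    (ws_min : global_minimizer f ws)
    (L_gt0 : 0 < L) (f_smooth : smooth L f)
    (rho_gt0 : 0 < rho) (f_quasar : quasar_convex rho f ws)
    (T_poisson : poisson_times T) :
  (forall (w0 z0 : 'rV[R]_d) (w z : R -> Omega -> 'rV[R]_d),
      {ae P, forall om,
        continuized_path
          (fun t => 2 / (rho * t)) (fun=> 0) (fun=> 1 / L)
          (fun t => rho * t / (2 * L))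
          f (fun k => T k om) w0 z0 (fun t => w t om) (fun t => z t om) /\
        singular_start (fun k => T k om) z0 (fun t => w t om)
          (fun t => z t om)} ->
      forall t : R, 0 < t ->
        ('E_P[fun om => (f (w t om) - f ws)%R]
           <= (2 * L * enorm (z0 - ws) ^+ 2 / (rho ^+ 2 * t ^+ 2))%:E)%E) /\
  (forall (w0 z0 : 'rV[R]_d) (k : nat),
      ('E_P[fun om => (T k om ^+ 2 *
              (f (discrete_algorithm
                    (fun j => 1 - (T j om / T j.+1 om) `^ (2 / rho))
                    (fun=> 0) (fun=> 1 / L)
                    (fun j => rho * T j om / (2 * L))
                    f w0 z0 k).1 - f ws))%R]
         <= (2 * L * enorm (z0 - ws) ^+ 2 / rho ^+ 2)%:E)%E).

Proof.
have [T0 Tlt _ _] := T_poisson.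
have stop_ge0 H t k w0 z0 : 0 <= stopped_potential f ws L rho w0 z0 H t k.
  exact: stopped_potential_ge0.
have mstop H k w0 z0 : measurable_fun setT
    (fun om => stopped_potential f ws L rho w0 z0 H (fun j => T j om) k).
  exact: (measurable_stopped_potential ws rho w0 z0 f_diff f_smooth).
have Estop H k w0 z0 := expectation_stopped_potential_le w0 z0 f_diff ws_min
  L_gt0 f_smooth rho_gt0 f_quasar T_poisson H k.
have potential_f t w z : t ^+ 2 * (f w - f ws) <= potential f ws L rho t w z.
  by rewrite lerDl mulr_ge0 ?dotp_ge0// divr_ge0 ?sqr_ge0// mulr_ge0// ltW.
have potential0 w0 z0 : potential f ws L rho 0 w0 z0 =
    2 * L * enorm (z0 - ws) ^+ 2 / rho ^+ 2.
  by rewrite /potential expr0n mul0r add0r enorm_sqr [RHS]mulrAC.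
split=> [w0 z0 w z paths t t0|w0 z0 k]; rewrite unlock.
- have t2 : 0 < t ^+ 2 by rewrite exprn_gt0.
  apply: (@ge0_integral_eventually_le _ _ _ P _
    (fun n om => (t ^- 2 *
       stopped_potential f ws L rho w0 z0 t (fun j => T j om) n)%:E)).
  + by move=> om; rewrite lee_fin subr_ge0 ws_min.
  + by move=> n om; rewrite lee_fin mulr_ge0// invr_ge0 ltW.
  + move=> n; apply/measurable_EFinP; exact: measurable_funM.
  + move=> n; under eq_integral do rewrite EFinM.
    rewrite ge0_integralZl//; last 3 first.
    * exact/measurable_EFinP.
    * by move=> om _; rewrite lee_fin.
    * by rewrite lee_fin invr_ge0 ltW.
    rewrite [leRHS](_ : _ = (t ^- 2)%:E * (potential f ws L rho 0 w0 z0)%:E)%E.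
      by rewrite lee_wpmul2l// lee_fin invr_ge0 ltW.
    by rewrite -EFinM potential0; congr EFin; rewrite invfM; ring.
  (* Once the number of jumps exceeds the index of the interval containing [t],
     the stopped potential is the potential at time [t] itself. *)
  + apply: filterS2 paths (poisson_times_unbounded T_poisson t).
    move=> om [path start] [m tm].
    have T0t : T 0%N om <= t by rewrite T0 ltW.
    have [j tj] := @jump_index _ (fun j => T j om) t m T0t tm.
    exists j.+1 => n jn; rewrite lee_fin.
    have [wzj between] := continuized_path_iterate rho_gt0 (T0 om)
      (fun k => Tlt k om) path start j.
    have wtE : w t om = flow rho (T j om) t
        (iterate f L rho w0 z0 (fun j => T j om) j).1
        (iterate f L rho w0 z0 (fun j => T j om) j).2.
      case/andP: (tj); rewrite le_eqVlt => /predU1P[tE _|lt_jt tltj].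
        by rewrite -wzj -tE /= flow_id// tE lt0r_neq0.
      by apply: (between _ _).1; rewrite lt_jt.
    rewrite (stopped_potential_after f ws L rho w0 z0
      (fun k => Tlt k om) tj jn).
    by rewrite -wtE -(ler_pM2l t2) mulrA divff ?lt0r_neq0// mul1r.
- apply: (@ge0_integral_eventually_le _ _ _ P _
    (fun n om => (stopped_potential f ws L rho w0 z0 n%:R
       (fun j => T j om) k)%:E)).
  + by move=> om; rewrite lee_fin mulr_ge0 ?sqr_ge0// subr_ge0 ws_min.
  + by move=> n om; rewrite lee_fin.
  + by move=> n; exact/measurable_EFinP.
  + by move=> n; rewrite -(potential0 w0).
  (* Here the number of jumps is fixed and it is the horizon that grows. *)
  + apply: aeW => om; exists (Num.truncn (T k om)).+1 => n Tn.
    have Tkn : T k om <= n%:R.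
      by rewrite (le_trans (ltW (truncnS_gt _)))// ler_nat.
    by rewrite lee_fin stopped_potential_before.
Qed.
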